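(* Let $1\le r\le n$, let $(\mathbf X^s,\mathbf U^s)$ be a stationary pair of stochastic processes, and let $(\varrho^s_X,\pi^s)$ be a corresponding stationary distribution–policy pair (i.e. $\varrho^s_X$ is the law of $X^s(k)$, and $(X,\pi^s(X))$ has the same law as $(X^s(k),U^s(k))$ for $X\sim\varrho^s_X$). Assume the stochastic optimal control problem is strictly $L^r$ dissipative at $(\mathbf X^s,\mathbf U^s)$. Then it is also strictly weakly distributionally dissipative at $(\varrho^s_X,\pi^s)$ (i.e. strictly distributionally dissipative with respect to the Lévy–Prokhorov metric) and strictly Wasserstein dissipative of order $s$ at $(\varrho^s_X,\pi^s)$ (i.e. strictly distributionally dissipative with respect to the Wasserstein distance of order $s$) for all $1\le s\le r$.
   Context: Setting. $\mathcal X,\mathcal U,\mathcal W$ are separable Banach spaces, $\|\cdot\|$ is the norm of $\mathcal X$, $(\Omega,\mathcal F,\mathbb P)$ is a probability space, $n,l\ge 1$ are fixed exponents, and $L^n(\Omega,\mathcal F,\mathbb P;\mathcal X)$ is the space of $\mathcal X$-valued random variables with finite $n$-th moment. $f:\mathcal X\times\mathcal U\times\mathcal W\to\mathcal X$ is continuous in $(x,u)$ for almost all $w$. $\mathbf W=(W(0),W(1),\dots)$ is a fixed i.i.d. sequence with distribution $\varrho_W$. The control system is $X(k+1)=f(X(k),U(k),W(k))$, $X(0)=X_0$, with $X(k)\in L^n(\Omega,\mathcal F_k,\mathbb P;\mathcal X)$, $U(k)\in L^l(\Omega,\mathcal F_k,\mathbb P;\mathcal U)$, $\mathcal F_k=\sigma(X(0),\dots,X(k))$;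 it is always required that $W(k)$ is independent of $(X(k),U(k))$. The trajectory is denoted $X_{\mathbf U}(k,X_0)$ or $X(k)$. The constraint set $\mathbb Y\subseteq L^n(\Omega,\mathcal F,\mathbb P;\mathcal X)\times L^l(\Omega,\mathcal F,\mathbb P;\mathcal U)$ is law-invariant (if $(X,U)\in\mathbb Y$ and $(Y,V)$ has the same joint law as $(X,U)$, then $(Y,V)\in\mathbb Y$); $\mathbb X:=\{X : \exists U,\ (X,U)\in\mathbb Y\}$. $\mathbb U^N(X_0)$ is the set of admissible control sequences $\mathbf U=(U(0),\dots,U(N-1))$ for $X_0\in\mathbb X$: $U(k)\in L^l(\Omega,\mathcal F_k,\mathbb P;\mathcal U)$, $(X(k),U(k))\in\mathbb Y$ for $k=0,\dots,N-1$, and $X(N)\in\mathbb X$; $\mathbb U^\infty(X_0)$ is defined analogously for infinite sequences ($(X(k),U(k))\in\mathbb Y$ for all $k\in\mathbb N_0$). It is assumed that $\mathbb U^\infty(X_0)\ne\emptyset$ for all $X_0\in\mathbb X$. The stage cost $\ell:\mathbb Y\to\mathbb R$ is law-invariant ($\ell(X,U)$ depends only on the joint law of $(X,U)$). Markov policies. $\Pi_0(\mathcal X,\mathcal U)$ is the set of (measurable) maps $\pi:\mathcal X\to\mathcal U$ with $\pi\circ X\in L^l(\Omega,\mathcal F,\mathbb P;\mathcal U)$ for all $X\in L^n(\Omega,\mathcal F,\mathbb P;\mathcal X)$. $\mathbb F^N(X_0)$ (for $N\in\mathbb N\cup\{\infty\}$) is the set of $\mathbf U\in\mathbb U^N(X_0)$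 such that for every $k<N$ there is $\pi_k\in\Pi_0(\mathcal X,\mathcal U)$ with $U(k)=\pi_k(X(k))$. The stochastic optimal control problem is to minimize $J_N(X_0,\mathbf U)=\sum_{k=0}^{N-1}\ell(X(k),U(k))$ over $\mathbf U\in\mathbb F^N(X_0)$. Stationarity. $(\mathbf X^s,\mathbf U^s)$ with $X^s(k+1)=f(X^s(k),U^s(k),W(k))$ (same noise $\mathbf W$), $\mathbf U^s\in\mathbb F^\infty(X^s(0))$, is stationary if the laws of $X^s(k)$, of $U^s(k)$ and of $(X^s(k),U^s(k))$ do not depend on $k\in\mathbb N_0$. Then $\ell(\mathbf X^s,\mathbf U^s)$ denotes the $k$-independent value $\ell(X^s(k),U^s(k))$. A pair $(\varrho^s_X,\pi^s)$ with $\pi^s\in\Pi_0(\mathcal X,\mathcal U)$ is a stationary distribution–policy pair if $f(X,\pi^s(X),W)\sim\varrho^s_X$ whenever $X\sim\varrho^s_X$ and $W\sim\varrho_W$ are independent. $\mathcal K_\infty$ is the set of continuous, strictly increasing, unbounded $\alpha:[0,\infty)\to[0,\infty)$ with $\alpha(0)=0$. $P_X$ is the law of $X$; $\mathcal P(\mathcal X)$ is the set of Borel probability measures on $\mathcal X$, $\mathcal P_n(\mathcal X)$ the subset of those with finite $n$-th moment. Strict $L^r$ dissipativity at $(\mathbf X^s,\mathbf U^s)$: there exist $\lambda:\mathbb N_0\times L^n(\Omega,\mathcal F,\mathbb P;\mathcal X)\to\mathbb R$ bounded from below and $\alpha\in\mathcal K_\infty$ such that $$\ell(X(k),U(k))-\ell(\mathbf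 X^s,\mathbf U^s)+\lambda(k,X(k))-\lambda(k+1,X(k+1))\ \ge\ \alpha\big(\mathbb E[\|X(k)-X^s(k)\|^r]\big)$$ for all $k\in\mathbb N_0$, $X_0\in\mathbb X$ and $\mathbf U\in\mathbb F^\infty(X_0)$, where $X(\cdot)=X_{\mathbf U}(\cdot,X_0)$. Strict distributional dissipativity at $(\varrho^s_X,\pi^s)$ with respect to a metric $d_D$ on $\mathcal P_n(\mathcal X)$: there exist $\Lambda:\mathcal P(\mathcal X)\to\mathbb R$ bounded from below and $\alpha\in\mathcal K_\infty$ such that $$\ell(X,\pi(X))-\ell(X',\pi^s(X'))+\Lambda(P_X)-\Lambda(P_{X^+})\ \ge\ \alpha(d_D(P_X,\varrho^s_X))$$ for all admissible $(X,\pi(X))\in\mathbb Y$ with $\pi\in\Pi_0(\mathcal X,\mathcal U)$, i.e. with $X^+:=f(X,\pi(X),W)\in\mathbb X$ ($W\sim\varrho_W$ independent of $X$), and all $X'\sim\varrho^s_X$. Metrics (infima over all couplings): $d_{W_s}(P_X,P_Y)=\inf\{(\mathbb E[\|\bar X-\bar Y\|^s])^{1/s}:\bar X\sim P_X,\bar Y\sim P_Y\}$ (Wasserstein of order $s$); $d_{LP}(P_X,P_Y)=\inf\{d_{KF}(\bar X,\bar Y):\bar X\sim P_X,\bar Y\sim P_Y\}$ (Lévy–Prokhorov), with $d_{KF}(X,Y)=\inf\{\varepsilon>0:\mathbb P(\|X-Y\|>\varepsilon)\le\varepsilon\}$.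
   Formalization: Assumes f jointly measurable; U^∞(X_0)≠∅ is asked only for X_0∈𝕏 independent of the noise W; adds that each X∈𝕏 has a copy of equal law in 𝕏 independent of W, and that, for X_0 independent of W, U^∞(X_0)≠∅ implies F^∞(X_0)≠∅ (the claim fails without this). *)

(* Defs.v *)
From mathcomp Require Import all_boot all_order all_algebra finmap.
From mathcomp Require Import all_classical all_reals all_analysis.

Set Implicit Arguments.
Unset Strict Implicit.
Unset Printing Implicit Defensive.
Import Order.TTheory GRing.Theory Num.Theory.
Import numFieldNormedType.Exports.
Local Open Scope classical_set_scope.
Local Open Scope ring_scope.

(* T with its Borel sigma-algebra; [borel T * borel T'] carries the product
   sigma-algebra, which is the Borel one when T and T' are separable. *)
Notation borel T := (g_sigma_algebraType (@open T)).

Definition separable (T : topologicalType) :=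
  exists2 D : set T, countable D & dense D.

Definition class_Kinfty (R : realType) (alpha : R -> R) :=
  [/\ {within `[0, +oo[, continuous alpha},
      {in `[0, +oo[ &, {homo alpha : x y / x < y}},
      alpha 0 = 0 &
      forall M, exists2 x, 0 <= x & M < alpha x].

Section laws.
Context {d : measure_display} {Omega : measurableType d} {R : realType}.
Variable P : probability Omega R.

(* Only values on measurable sets matter: the type [probability T R] leaves the
   values on other sets unspecified. *)
Definition has_law d' (T : measurableType d') (X : Omega -> T)
    (mu : probability T R) :=
  forall A : set T, measurable A -> pushforward P X A = mu A.

Definition same_law d' (T : measurableType d') (X Y : Omega -> T) :=
  forall A : set T, measurable A -> pushforward P X A = pushforward P Y A.

Definition indep d1 d2 (T1 : measurableType d1) (T2 : measurableType d2)
    (X : Omega -> T1) (Y : Omega -> T2) :=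
  forall (A : set T1) (B : set T2), measurable A -> measurable B ->
    P (X @^-1` A `&` Y @^-1` B) = (P (X @^-1` A) * P (Y @^-1` B))%E.

Definition mutual_indep d' (T : measurableType d') (Z : nat -> Omega -> T) :=
  forall (J : {fset nat}) (B : nat -> set T), (forall i, measurable (B i)) ->
    P (\bigcap_(i in [set` J]) (Z i @^-1` B i)) =
    (\prod_(i <- J) P (Z i @^-1` B i))%E.

Definition iid d' (T : measurableType d') (Z : nat -> Omega -> T)
    (rho : probability T R) :=
  mutual_indep Z /\ forall k, has_law (Z k) rho.

Definition sigma_family d' (T : measurableType d') (Z : nat -> Omega -> T)
    (I : set nat) : set (set Omega) :=
  <<s \bigcup_(i in I) preimage_set_system setT (Z i) measurable >>.

Definition indep_process d1 d2 (T1 : measurableType d1)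
    (T2 : measurableType d2) (X : Omega -> T1) (Z : nat -> Omega -> T2) :=
  forall (A : set T1) (B : set Omega), measurable A -> sigma_family Z setT B ->
    P (X @^-1` A `&` B) = (P (X @^-1` A) * P B)%E.

Definition moment (T : completeNormedModType R) (p : R) (X : Omega -> T) :
  \bar R := ('E_P[fun t => (`|X t| `^ p)%R])%E.

Definition finite_moment (T : completeNormedModType R) (p : R)
    (X : {RV P >-> borel T}) := (moment p (X : Omega -> T) < +oo)%E.

Definition ky_fan (T : completeNormedModType R) (X Y : Omega -> T) : R :=
  inf [set e : R | 0 < e /\ (P [set t | (e < `|X t - Y t|)%R] <= e%:E)%E].

End laws.

Section metrics.
Context {R : realType} {T : completeNormedModType R}.
Implicit Types mu nu : probability (borel T) R.

Definition coupling mu nu : set (probability (borel T * borel T)%type R) :=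
  [set gamma | has_law gamma fst mu /\ has_law gamma snd nu].

(* Finite when mu and nu have finite s-th moments, so that [fine] is then
   harmless. *)
Definition wasserstein (s : R) mu nu : R :=
  fine (ereal_inf
    [set poweR (moment gamma s (fun p => (p.1 : T) - (p.2 : T))) s^-1
       | gamma in coupling mu nu]).

Definition levy_prokhorov mu nu : R :=
  inf [set ky_fan gamma (fun p => p.1 : T) (fun p => p.2 : T)
       | gamma in coupling mu nu].

End metrics.

Section control.
Context {d : measure_display} {Omega : measurableType d} {R : realType}.
Variable P : probability Omega R.
Variables TX TU TW : completeNormedModType R.
Variables n l : R.
Variable f : TX -> TU -> TW -> TX.
Variable W : nat -> {RV P >-> borel TW}.
Variable rhoW : probability (borel TW) R.
Variable Y : set ({RV P >-> borel TX} * {RV P >-> borel TU}).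
Variable ell : {RV P >-> borel TX} -> {RV P >-> borel TU} -> R.

Definition joint (X : Omega -> borel TX) (U : Omega -> borel TU) (t : Omega) :
  borel TX * borel TU := (X t, U t).

Definition caratheodory :=
  measurable_fun setT
    (fun p : borel TX * borel TU * borel TW => f p.1.1 p.1.2 p.2 : borel TX) /\
  {ae rhoW, forall w, continuous (fun p : TX * TU => f p.1 p.2 w)}.

Definition constraint_in_L :=
  forall X U, Y (X, U) -> finite_moment n X /\ finite_moment l U.

Definition constraint_law_invariant :=
  forall (X X' : {RV P >-> borel TX}) (U U' : {RV P >-> borel TU}),
    Y (X, U) -> same_law P (joint X U) (joint X' U') -> Y (X', U').

Definition cost_law_invariant :=
  forall (X X' : {RV P >-> borel TX}) (U U' : {RV P >-> borel TU}),
    Y (X, U) -> Y (X', U') ->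
    same_law P (joint X U) (joint X' U') -> ell X U = ell X' U'.

(* The set $\mathbb{X}$ of feasible states. *)
Definition state_set : set {RV P >-> borel TX} := [set X | exists U, Y (X, U)].

(* [admissible X U]: X is the trajectory of U from X 0, and U is an element of
   $\mathbb{U}^\infty(X(0))$. *)
Definition admissible (X : nat -> {RV P >-> borel TX})
    (U : nat -> {RV P >-> borel TU}) :=
  [/\ forall k t, X k.+1 t = f (X k t) (U k t) (W k t),
      forall k, indep P (W k) (joint (X k) (U k)),
      forall k, finite_moment n (X k),
      forall k, finite_moment l (U k) /\
        (forall B : set (borel TU), measurable B ->
           sigma_family X `I_k.+1 (U k @^-1` B)) &
      forall k, Y (X k, U k)].

(* The set $\Pi_0$ of policies. *)
Definition policy (pi : {mfun borel TX >-> borel TU}) :=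
  forall X : {RV P >-> borel TX}, finite_moment n X ->
    (moment P l (fun t => pi (X t) : TU) < +oo)%E.

(* [admissible X U] with U in $\mathbb{F}^\infty(X(0))$. *)
Definition markov_admissible X U :=
  admissible X U /\
  forall k, exists2 pi, policy pi & forall t, U k t = pi (X k t).

Definition stationary Xs Us :=
  [/\ markov_admissible Xs Us,
      forall k, same_law P (Xs k) (Xs 0%N),
      forall k, same_law P (Us k) (Us 0%N) &
      forall k, same_law P (joint (Xs k) (Us k)) (joint (Xs 0%N) (Us 0%N))].

Definition stationary_pair (rho : probability (borel TX) R)
    (pi : {mfun borel TX >-> borel TU}) :=
  policy pi /\
  forall (X : {RV P >-> borel TX}) (V : {RV P >-> borel TW}),
    has_law P X rho -> has_law P V rhoW -> indep P X V ->
    has_law P (fun t => f (X t) (pi (X t)) (V t) : borel TX) rho.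

(* rho and pi describe the law of Xs and the joint law of (Xs, Us). *)
Definition corresponding (Xs : nat -> {RV P >-> borel TX})
    (Us : nat -> {RV P >-> borel TU}) (rho : probability (borel TX) R)
    (pi : {mfun borel TX >-> borel TU}) :=
  (forall k, has_law P (Xs k) rho) /\
  forall (X : {RV P >-> borel TX}) k, has_law P X rho ->
    same_law P (joint X (pi \o X)) (joint (Xs k) (Us k)).

(* For a stationary (Xs, Us) and a law-invariant cost, ell (Xs k) (Us k) does
   not depend on k; we take k = 0. *)
Definition strict_Lr_dissipative (r : R) (Xs : nat -> {RV P >-> borel TX})
    (Us : nat -> {RV P >-> borel TU}) :=
  exists (lambda : nat -> {RV P >-> borel TX} -> R) (alpha : R -> R),
  [/\ exists m, forall k X, finite_moment n X -> m <= lambda k X,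
      class_Kinfty alpha &
      forall X U, markov_admissible X U -> forall k,
        alpha (fine (moment P r (fun t => (X k t : TX) - (Xs k t : TX)))) <=
        ell (X k) (U k) - ell (Xs 0%N) (Us 0%N)
          + lambda k (X k) - lambda k.+1 (X k.+1)].

(* U, U' and Xp are the random variables pi(X), pis(X') and
   X^+ = f(X, pi(X), V). *)
Definition strict_distributional_dissipative
    (dD : probability (borel TX) R -> probability (borel TX) R -> R)
    (rhos : probability (borel TX) R) (pis : {mfun borel TX >-> borel TU}) :=
  exists (Lambda : probability (borel TX) R -> R) (alpha : R -> R),
  [/\ exists m, forall mu, m <= Lambda mu,
      class_Kinfty alpha &
      forall (pi : {mfun borel TX >-> borel TU})
        (X Xp X' : {RV P >-> borel TX}) (U U' : {RV P >-> borel TU})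
        (V : {RV P >-> borel TW}) (mu mup : probability (borel TX) R),
      policy pi -> (forall t, U t = pi (X t)) -> Y (X, U) ->
      has_law P V rhoW -> indep P X V ->
      (forall t, Xp t = f (X t) (U t) (V t)) -> state_set Xp ->
      has_law P X' rhos -> (forall t, U' t = pis (X' t)) ->
      has_law P X mu -> has_law P Xp mup ->
      alpha (dD mu rhos) <= ell X U - ell X' U' + Lambda mu - Lambda mup].

(* A trajectory needs an initial value independent of the noise, whereas the
   law-invariant set [state_set] also contains values that depend on it.
   Non-emptiness of $\mathbb{U}^\infty(X_0)$ is asked of the former only, and
   Omega is required to contain enough of them. *)
Definition feasible :=
  forall X0, state_set X0 -> indep_process P X0 W ->
    exists X U, X 0%N = X0 /\ admissible X U.

Definition noise_independent_copies :=
  forall X, state_set X ->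
    exists X0, [/\ state_set X0, same_law P X0 X & indep_process P X0 W].

(* $\mathbb{U}^\infty(X_0)\neq\emptyset$ implies
   $\mathbb{F}^\infty(X_0)\neq\emptyset$. This is not automatic: [policy]
   demands integrability of pi along every X with finite n-th moment. *)
Definition markov_feasible :=
  forall X U, admissible X U -> indep_process P (X 0%N) W ->
    exists X' U', X' 0%N = X 0%N /\ markov_admissible X' U'.

End control.

(* Main.v *)
Require Import Defs.
From mathcomp Require Import all_boot all_order all_algebra finmap.
From mathcomp Require Import all_classical all_reals all_analysis.
From mathcomp Require Import measurable_realfun.
From mathcomp Require Import lra.

Set Implicit Arguments.
Unset Strict Implicit.
Unset Printing Implicit Defensive.
Import Order.TTheory GRing.Theory Num.Theory.
Import numFieldNormedType.Exports.
Local Open Scope classical_set_scope.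
Local Open Scope ring_scope.

(** The storage function is Willems' available storage, formed on laws: the
    value at a law mu is the supremum, over all Markov trajectories whose initial
    law is mu and over all finite horizons, of the accumulated supply

      ell(Xs, Us) - ell(X(k), U(k)) + beta (d (law of X(k), rhos)).

    The supply depends only on the joint law of state and control, so this is a
    function of mu, and two facts are needed.

    Finiteness. Coupling X(k) with the stationary state Xs(k) on Omega itself
    bounds the distance of their laws by the moment of their difference:
    d_W ^ r and d_LP ^ (r + 1) are at most E |X(k) - Xs(k)| ^ r
    ([wasserstein_powR_le], [levy_prokhorov_powR_le]). With
    beta x = alpha (x ^ p), the supply is therefore at most the decrease of the
    given random storage lambda(k, X(k)), and the accumulated supply telescopes to
    at most lambda(0, X(0)) - inf lambda ([total_supply_le]). This bound depends
    on X(0) and not only on its law. But every trajectory can be replayed, with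
    the same policies and hence the same laws, from one fixed initial value X0
    that is independent of the noise ([replay]), so lambda(0, X0) - inf lambda
    bounds all supplies available from mu.

    Dissipation. A transition X -> Xp under a policy pi can be put in front of
    any trajectory that starts with the law of Xp: replay pi first and then the
    policies of the trajectory, from a noise-independent copy of X. The resulting
    trajectory starts with the law of X and has supplied one more term, which is
    the dissipation inequality ([available_storage_dissipates]).

    Replaying rests on the fact that the state of a closed loop at time k is
    independent of the noise from time k on ([trajectory_indep_future]), so that
    its law at time k + 1 is determined by its law at time k. *)

(** * Measures on products and joint laws *)

Section rectangles.
Context {R : realType} {d1 d2 : measure_display}.
Context {T1 : measurableType d1} {T2 : measurableType d2}.

(** Rectangles are stable under intersection and generate the product
    sigma-algebra, so a finite measure is determined by its values on them. *)
Lemma measure_eq_rectangles (m1 m2 : {measure set (T1 * T2) -> \bar R}) :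
  (m1 setT < +oo)%E ->
  (forall A B, measurable A -> measurable B -> m1 (A `*` B) = m2 (A `*` B)) ->
  forall E, measurable E -> m1 E = m2 E.
Proof.
move=> m1oo m12 E mE.
pose G := [set A `*` B | A in @measurable _ T1 & B in @measurable _ T2].
apply: (measure_unique G (fun=> setT)) => //.
- exact: measurable_prod_measurableType.
- move=> _ _ [A1 mA1 [B1 mB1 <-]] [A2 mA2 [B2 mB2 <-]].
  exists (A1 `&` A2); first exact: measurableI.
  by exists (B1 `&` B2); [exact: measurableI|rewrite setXI].
- by move=> _; exists setT => //; exists setT => //; rewrite setXTT.
- by rewrite bigcup_const.
- by move=> _ [A mA [B mB <-]]; exact: m12.
Qed.

Context {d : measure_display} {Omega : measurableType d}.
Variable P : probability Omega R.

Definition rv_of d' (T : measurableType d') (F : Omega -> T)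
  (mF : measurable_fun setT F) : {RV P >-> T} := mfun_Sub (mem_set mF).

Lemma measurable_event d' (T : measurableType d') (Z : {RV P >-> T}) A :
  measurable A -> measurable (Z @^-1` A).
Proof. by move=> mA; rewrite -[_ @^-1` _]setTI; exact: measurable_funP. Qed.

Lemma same_law_pair_indep (X X' : {RV P >-> T1}) (V V' : {RV P >-> T2}) :
  indep P X V -> indep P X' V' -> same_law P X X' -> same_law P V V' ->
  same_law P (fun t => (X t, V t)) (fun t => (X' t, V' t)).
Proof.
move=> iXV iXV' XX' VV' E mE.
have mXV : measurable_fun setT (fun t => (X t, V t)).
  exact: measurable_fun_pair.
have mXV' : measurable_fun setT (fun t => (X' t, V' t)).
  exact: measurable_fun_pair.
apply: (measure_eq_rectangles
  (m1 := distribution P (rv_of mXV)) (m2 := distribution P (rv_of mXV'))) => //.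
  exact: (le_lt_trans (probability_le1 (distribution P (rv_of mXV))
    measurableT) (ltry 1)).
move=> A B mA mB; rewrite /distribution /=.
transitivity (P (X @^-1` A `&` V @^-1` B)); first by [].
rewrite iXV//.
transitivity (P (X' @^-1` A `&` V' @^-1` B)); last by [].
by rewrite iXV'//; congr (_ * _)%E; [exact: XX'|exact: VV'].
Qed.

(** For fixed C both sides are finite measures in E: the law of (X, V) under P
    restricted to C, and P(C) times the law of (X, V). *)
Lemma indep_event_rectangles (X : {RV P >-> T1}) (V : {RV P >-> T2}) C :
  measurable C ->
  (forall A B, measurable A -> measurable B ->
     P ((X @^-1` A `&` V @^-1` B) `&` C) =
     (P (X @^-1` A `&` V @^-1` B) * P C)%E) ->
  forall E, measurable E ->
    P ((fun t => (X t, V t)) @^-1` E `&` C) =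
    (P ((fun t => (X t, V t)) @^-1` E) * P C)%E.
Proof.
move=> mC rect E mE.
have mXV : measurable_fun setT (fun t => (X t, V t)).
  exact: measurable_fun_pair.
have PC : P C = (fine (P C))%:E by rewrite fineK// fin_num_measure.
have PC0 : 0 <= fine (P C) by rewrite fine_ge0.
pose m1 := pushforward (mrestr P mC) (rv_of mXV).
pose m2 := mscale (NngNum PC0) (distribution P (rv_of mXV)).
have m2E A : m2 A = (P ((fun t => (X t, V t)) @^-1` A) * P C)%E.
  by rewrite muleC PC.
rewrite -m2E.
apply: (measure_eq_rectangles (m1 := m1) (m2 := m2)) => //.
  rewrite /m1 /pushforward /mrestr (le_lt_trans _ (ltry 1))//.
  by apply: probability_le1; rewrite preimage_setT setTI.
by move=> A B mA mB; apply: etrans (rect A B mA mB) _; exact/esym/m2E.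
Qed.

End rectangles.

(** * Independence of the state and the future noise *)

Section noise.
Context {R : realType} {d d1 d2 : measure_display} {Omega : measurableType d}.
Context {T1 : measurableType d1} {T2 : measurableType d2}.
Variable P : probability Omega R.
Variable W : nat -> {RV P >-> T2}.
Hypothesis Windep : mutual_indep P W.

Definition cylinder (J : {fset nat}) (B : nat -> set T2) : set Omega :=
  \bigcap_(i in [set` J]) (W i @^-1` B i).

Lemma measurable_cylinder J B : (forall i, measurable (B i)) ->
  measurable (cylinder J B).
Proof.
move=> mB; apply: fin_bigcap_measurable; first exact: finite_fset.
by move=> i _; exact: measurable_event.
Qed.

Lemma cylinder_sigma_family J B : (forall i, measurable (B i)) ->
  sigma_family W setT (cylinder J B).
Proof.
move=> mB; rewrite /sigma_family; set G := (G in <<s G >>).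
apply: (@fin_bigcap_measurable _ (g_sigma_algebraType G)).
  exact: finite_fset.
move=> i _; apply: sub_sigma_algebra; exists i => //.
by exists (B i) => //; rewrite setTI.
Qed.

Lemma cylinder_consK k B J b : k \notin J ->
  cylinder (k |` J)%fset (fun i => if i == k then b else B i) =
  W k @^-1` b `&` cylinder J B.
Proof.
move=> kJ; apply/seteqP; split=> [t Ct|t [bt Ct] i /=].
  split=> [|i /= iJ].
    by have := Ct k; rewrite /= eqxx; apply; rewrite !inE eqxx.
  have := Ct i; rewrite /= ifF; first by apply; rewrite !inE iJ orbT.
  by apply: contraNF kJ => /eqP <-.
rewrite !inE => /orP[/eqP->|iJ]; first by rewrite eqxx.
have -> : (i == k) = false by apply: contraNF kJ => /eqP <-.
exact: Ct.
Qed.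

Lemma cylinder1 k (B : nat -> set T2) :
  cylinder [fset k]%fset B = W k @^-1` B k.
Proof.
apply/seteqP; split=> [t|t Bt i /=]; first by apply; rewrite /= inE.
by rewrite inE => /eqP->.
Qed.

Lemma cylinder_consM k B J b : k \notin J -> measurable b ->
  (forall i, measurable (B i)) ->
  P (W k @^-1` b `&` cylinder J B) = (P (W k @^-1` b) * P (cylinder J B))%E.
Proof.
move=> kJ mb mB; rewrite -cylinder_consK// /cylinder.
rewrite !Windep//; last by move=> i; case: ifP.
rewrite big_fsetU1//= eqxx; congr (_ * _)%E.
rewrite !big_seq; apply: eq_bigr => i iJ.
by have -> : (i == k) = false by apply: contraNF kJ => /eqP <-.
Qed.

Variables (g : nat -> T1 * T2 -> T1) (Z : nat -> {RV P >-> T1}).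
Hypothesis mg : forall k, measurable_fun setT (g k).
Hypothesis Zrec : forall k t, Z k.+1 t = g k (Z k t, W k t).
Hypothesis Z0 : indep_process P (Z 0) W.

(** By induction on k. Z(k+1) is a function of (Z(k), W(k)), hence it suffices
    that this pair is independent of a cylinder C over the times after k. On a
    rectangle a x b the event W(k) in b joins C to form a cylinder over the times
    from k on, to which the induction hypothesis applies. *)
Lemma trajectory_indep_future k J B A :
  (forall i, i \in J -> (k <= i)%N) -> (forall i, measurable (B i)) ->
  measurable A ->
  P (Z k @^-1` A `&` cylinder J B) = (P (Z k @^-1` A) * P (cylinder J B))%E.
Proof.
elim: k J B A => [|k IH] J B A kJ mB mA.
  by apply: Z0 => //; exact: cylinder_sigma_family.
have kNJ : k \notin J by apply/negP => /kJ; rewrite ltnn.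
have -> : Z k.+1 @^-1` A = (fun t => (Z k t, W k t)) @^-1` (g k @^-1` A).
  by apply/seteqP; split=> t /=; rewrite Zrec.
have mgA : measurable (g k @^-1` A) by rewrite -[_ @^-1` _]setTI; exact: mg.
apply: indep_event_rectangles => //; first exact: measurable_cylinder.
move=> a b ma mb.
have consle i : i \in (k |` J)%fset -> (k <= i)%N.
  by rewrite !inE => /orP[/eqP->//|/kJ/ltnW].
have mbB i : measurable (if i == k then b else B i) by case: ifP.
have -> : P (Z k @^-1` a `&` W k @^-1` b) =
    (P (Z k @^-1` a) * P (W k @^-1` b))%E.
  have := IH [fset k]%fset (fun=> b) a _ (fun=> mb) ma.
  by rewrite cylinder1; apply => i; rewrite inE => /eqP->.
rewrite -setIA -(cylinder_consK _ _ kNJ) IH// cylinder_consK//.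
by rewrite cylinder_consM// muleA.
Qed.

Lemma trajectory_indep_noise k : indep P (Z k) (W k).
Proof.
move=> A b mA mb.
have := trajectory_indep_future (k := k) (J := [fset k]%fset) _ (fun=> mb) mA.
by rewrite cylinder1; apply => i; rewrite inE => /eqP->.
Qed.

End noise.

(** * Replaying a trajectory from another initial value *)

Section replay.
Context {R : realType} {TX TU TW : completeNormedModType R}.
Context {d : measure_display} {Omega : measurableType d}.
Variables (P : probability Omega R) (n l : R) (f : TX -> TU -> TW -> TX).
Variables (W : nat -> {RV P >-> borel TW}) (rhoW : probability (borel TW) R).
Variable Y : set ({RV P >-> borel TX} * {RV P >-> borel TU}).

Lemma same_law_comp d1 d2 (T1 : measurableType d1) (T2 : measurableType d2)
    (h : T1 -> T2) (X X' : Omega -> T1) : measurable_fun setT h ->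
  same_law P X X' -> same_law P (h \o X) (h \o X').
Proof.
move=> mh XX' A mA; have mhA : measurable (h @^-1` A).
  by rewrite -[_ @^-1` _]setTI; exact: mh.
exact: (XX' _ mhA).
Qed.

Lemma indep_comp d1 d2 d3 (T1 : measurableType d1) (T2 : measurableType d2)
    (T3 : measurableType d3) (h : T1 -> T2) (X : Omega -> T1)
    (V : Omega -> T3) : measurable_fun setT h ->
  indep P X V -> indep P (h \o X) V.
Proof.
move=> mh iXV A B mA mB; rewrite comp_preimage; apply: iXV => //.
by rewrite -[_ @^-1` _]setTI; exact: mh.
Qed.

Lemma indepC d1 d2 (T1 : measurableType d1) (T2 : measurableType d2)
    (X : Omega -> T1) (V : Omega -> T2) : indep P X V -> indep P V X.
Proof. by move=> iXV A B mA mB; rewrite setIC muleC; exact: iXV. Qed.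

Lemma has_law_same d' (T : measurableType d') (X X' : Omega -> T)
    (mu : probability T R) :
  has_law P X mu -> has_law P X' mu -> same_law P X X'.
Proof. by move=> Xmu X'mu A mA; rewrite Xmu// X'mu. Qed.

Lemma same_law_has d' (T : measurableType d') (X X' : Omega -> T)
    (mu : probability T R) :
  same_law P X X' -> has_law P X' mu -> has_law P X mu.
Proof. by move=> XX' X'mu A mA; rewrite XX'// X'mu. Qed.

Hypothesis mf : measurable_fun setT
  (fun p : borel TX * borel TU * borel TW => f p.1.1 p.1.2 p.2 : borel TX).

Definition closed_loop (pi : {mfun borel TX >-> borel TU})
  (p : borel TX * borel TW) : borel TX := f p.1 (pi p.1) p.2.

Lemma measurable_closed_loop pi : measurable_fun setT (closed_loop pi).
Proof.
apply: (measurableT_comp mf (g := fun p : borel TX * borel TW =>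
  (p.1, pi p.1, p.2))).
apply: measurable_fun_pair => //; apply: measurable_fun_pair => //.
exact: measurableT_comp.
Qed.

Lemma measurable_graph (pi : {mfun borel TX >-> borel TU}) :
  measurable_fun setT (fun x => (x, pi x)).
Proof. exact: measurable_fun_pair. Qed.

Hypotheses (Wiid : iid P W rhoW) (YL : constraint_in_L n l Y).
Hypothesis Ylaw : constraint_law_invariant Y.

(** The reference (X, U) need not be a trajectory of the noise W: each step may be
    driven by its own noise variable V(k), and X(k+1) has to agree with the
    successor of X(k) in law only. This makes it possible to concatenate a single
    transition with a trajectory that starts from another variable of the same
    law. *)
Lemma replay (pi : nat -> {mfun borel TX >-> borel TU})
    (X0 : {RV P >-> borel TX}) (X : nat -> {RV P >-> borel TX})
    (U : nat -> {RV P >-> borel TU}) (V : nat -> {RV P >-> borel TW}) :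
  indep_process P X0 W -> same_law P X0 (X 0) ->
  (forall k, policy P n l (pi k)) -> (forall k t, U k t = pi k (X k t)) ->
  (forall k, Y (X k, U k)) ->
  (forall k, has_law P (V k) rhoW) -> (forall k, indep P (X k) (V k)) ->
  (forall k,
     same_law P (X k.+1) (fun t => f (X k t) (U k t) (V k t) : borel TX)) ->
  exists Z Q, [/\ markov_admissible n l f W Y Z Q, Z 0 = X0 &
    forall k, same_law P (joint (Z k) (Q k)) (joint (X k) (U k))].
Proof.
move=> X0W X0X piP Upi YXU Vlaw XV Xnext.
have mnext k (z : {RV P >-> borel TX}) :
    measurable_fun setT (closed_loop (pi k) \o (fun t => (z t, W k t))).
  apply: measurableT_comp; first exact: measurable_closed_loop.
  exact: measurable_fun_pair.
pose Z := fix Z k := if k is k'.+1 then rv_of P (mnext k' (Z k')) else X0.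
have mQ k : measurable_fun setT (pi k \o Z k) by exact: measurableT_comp.
pose Q k := rv_of P (mQ k).
have ZW k : indep P (Z k) (W k).
  apply: (trajectory_indep_noise Wiid.1 (fun=> measurable_closed_loop _)) => //.
have ZX k : same_law P (Z k) (X k).
  elim: k => [//|k IH] A mA; rewrite Xnext//.
  have -> : (fun t => f (X k t) (U k t) (V k t) : borel TX) =
      closed_loop (pi k) \o (fun t => (X k t, V k t)).
    by apply/funext => t; rewrite Upi.
  apply: (same_law_comp (measurable_closed_loop (pi k))) => //.
  apply: same_law_pair_indep => //.
  exact: has_law_same (Wiid.2 k) (Vlaw k).
have ZQ k : same_law P (joint (Z k) (Q k)) (joint (X k) (U k)).
  have -> : joint (X k) (U k) = (fun x => (x, pi k x)) \o X k.
    by apply/funext => t; rewrite /joint Upi.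
  exact: (same_law_comp (measurable_graph (pi k)) (ZX k)).
have YZQ k : Y (Z k, Q k) by apply: Ylaw (YXU k) _ => A mA; rewrite ZQ.
exists Z, Q; split => //; split=> [|k]; last by exists (pi k).
split=> //.
- move=> k; apply: indepC.
  exact: (indep_comp (measurable_graph (pi k)) (ZW k)).
- by move=> k; have [] := YL (YZQ k).
- move=> k; split=> [|B mB]; first by have [] := YL (YZQ k).
  apply: sub_sigma_algebra; exists k => /=; first exact: ltnSn.
  exists (pi k @^-1` B); last by rewrite setTI.
  by rewrite -[_ @^-1` _]setTI; exact: measurable_funP.
Qed.

End replay.

(** * Comparison functions *)

Section Kinfty.
Context {R : realType}.
Implicit Types (alpha : R -> R) (p : R).

(** The restriction to [0, +oo[ matters at 0: for a negative base [powR] is 1. *)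
Lemma powR_continuous_nneg p : 0 < p ->
  {within `[0, +oo[, continuous (fun x : R => x `^ p)}.
Proof.
move=> p0; apply/subspace_continuousP => x.
rewrite /= in_itv/= andbT le_eqVlt => /predU1P[<-|x0].
  rewrite [X in _ --> X]powR0 ?gt_eqF//; apply/cvgrPdist_lt => e e0.
  rewrite near_withinE; near=> y; rewrite /= in_itv/= andbT => y0.
  rewrite sub0r normrN ger0_norm ?powR_ge0//.
  rewrite -[ltRHS]powRr1 ?ltW// -(mulVf (lt0r_neq0 p0)) powRrM.
  rewrite gt0_ltr_powR ?nnegrE ?powR_ge0//.
  near: y; apply: lt_nbhsl.
  by rewrite powR_gt0.
apply: cvg_within_filter.
apply: differentiable_continuous; apply/derivable1_diffP.
by apply: derivable_powR; rewrite in_itv/= x0.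
Unshelve. all: by end_near. Qed.

Lemma Kinfty_le alpha x y : class_Kinfty alpha -> 0 <= x -> x <= y ->
  alpha x <= alpha y.
Proof.
move=> [_ alpha_lt _ _] x0; rewrite le_eqVlt => /predU1P[->//|xy].
by apply/ltW/alpha_lt; rewrite ?in_itv/= ?andbT// ltW// (le_lt_trans x0).
Qed.

Lemma Kinfty_powR alpha p : class_Kinfty alpha -> 0 < p ->
  class_Kinfty (fun x => alpha (x `^ p)).
Proof.
move=> [acont alt a0 aunb] p0; split.
- apply/subspace_continuousP => x x0.
  apply: (cvg_comp (G := within `[0, +oo[ (nbhs (x `^ p))) (fun y => y `^ p) alpha).
    have /subspace_continuousP/(_ x x0) pcont := powR_continuous_nneg p0.
    move=> B /pcont; rewrite /= /nbhs/= /within/= => xB.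
    near=> y => y0; apply: (near xB y) => //.
    by rewrite /= in_itv/= powR_ge0.
  move/subspace_continuousP : acont; apply.
  by rewrite /= in_itv/= powR_ge0.
- move=> x y; rewrite !in_itv/= !andbT => x0 y0 xy.
  by apply: alt; rewrite ?in_itv/= ?powR_ge0// gt0_ltr_powR.
- by rewrite powR0 ?gt_eqF.
- move=> M; have [x x0 Mx] := aunb M; exists (x `^ p^-1); first exact: powR_ge0.
  by rewrite -powRrM mulVf ?gt_eqF// powRr1.
Unshelve. all: by end_near. Qed.

(** This turns estimates of a metric D by thresholds a that dominate m into a
    bound on a power of D, without assuming that m is positive (for m = 0 the
    threshold m ^ (1/p) itself is excluded). *)
Lemma powR_le_of_dominated (D m p : R) : 0 < p -> 0 <= m -> 0 <= D ->
  (forall a, 0 < a -> m <= a `^ p -> D <= a) -> D `^ p <= m.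
Proof.
move=> p0 m0 D0 Dle; rewrite leNgt; apply/negP => mD.
pose b := (m + D `^ p) / 2.
have mb : m < b by rewrite /b; lra.
have bD : b < D `^ p by rewrite /b; lra.
have b0 : 0 < b by exact: le_lt_trans mb.
have bp : (b `^ p^-1) `^ p = b.
  by rewrite -powRrM mulVf ?gt_eqF// powRr1// ltW.
have := Dle _ (powR_gt0 p^-1 b0); rewrite bp => /(_ (ltW mb)) Db.
have := @ge0_ler_powR _ _ (ltW p0) D (b `^ p^-1).
rewrite !nnegrE powR_ge0 D0 bp => /(_ isT isT Db).
by rewrite leNgt bD.
Qed.

End Kinfty.

(** * Distances and moments in a separable Banach space *)

Section distances.
Context {R : realType} {TX : completeNormedModType R}.

Lemma measurable_fun_lt d (T : measurableType d) (g : T -> R) :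
  (forall c, measurable (g @^-1` `]-oo, c[%classic)) -> measurable_fun setT g.
Proof.
move=> mg; apply: (measurability _ (RGenInftyO.measurableE R)).
by move=> _ [_ [c ->] <-]; rewrite setTI.
Qed.

Lemma measurable_continuous_borel (g : TX -> R) : continuous g ->
  measurable_fun setT (g : borel TX -> R).
Proof.
move=> /continuousP cg; apply: measurable_fun_lt => c.
by apply: sub_sigma_algebra; exact/cg/interval_open.
Qed.

(** Subtraction need not be measurable for the product sigma-algebra in general.
    Here |x - y| < c holds iff |x - z| + |y - z| < c for some z in the countable
    dense set, which is a countable union of measurable conditions. *)
Lemma measurable_dist : separable TX ->
  measurable_fun setT (fun p : borel TX * borel TX => `|(p.1 : TX) - (p.2 : TX)|).
Proof.
move=> [D Dcount Ddense]; apply: measurable_fun_lt => c.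
have -> : (fun p : borel TX * borel TX => `|(p.1 : TX) - (p.2 : TX)|) @^-1`
    `]-oo, c[%classic =
  \bigcup_(z in D) (fun p : borel TX * borel TX =>
    `|(p.1 : TX) - z| + `|(p.2 : TX) - z|) @^-1` `]-oo, c[%classic.
  apply/seteqP; split => [[x y]|[x y] [z Dz]] /=; rewrite !in_itv/=; last first.
    apply: le_lt_trans; rewrite (distrC (y : TX)).
    by rewrite (le_trans _ (ler_normD _ _))// addrA subrK.
  move=> xyc; pose e := (c - `|(x : TX) - (y : TX)|) / 2.
  have e0 : 0 < e by rewrite /e divr_gt0// subr_gt0.
  have [z [xz Dz]] : ball (x : TX) e `&` D !=set0.
    apply: Ddense; last exact: ball_open.
    by exists x; exact: ballxx.
  exists z => //=; rewrite in_itv/=.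
  have {}xz : `|(x : TX) - z| < e by move: xz; rewrite -ball_normE.
  have yz : `|(y : TX) - z| <= `|(x : TX) - (y : TX)| + `|(x : TX) - z|.
    by rewrite (distrC (x : TX) y) (le_trans _ (ler_normD _ _))// addrA subrK.
  by move: yz xz; rewrite /e; lra.
rewrite bigcup_set_type; apply: countable_bigcupT_measurable.
  move/countable_injP : Dcount => [j jinj]; apply/countable_injP.
  by exists (j \o val) => u v _ _ /= juv; apply/val_inj/jinj => //; exact: valP.
move=> z; have mdist : measurable_fun setT
    (fun x : borel TX => `|(x : TX) - val z|).
  apply: measurable_continuous_borel => x.
  by apply: cvg_norm; apply: cvgB; [exact: cvg_id|exact: cvg_cst].
rewrite -[_ @^-1` _]setTI.
apply: (measurable_funD (measurableT_comp mdist measurable_fst)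
  (measurableT_comp mdist measurable_snd)) => //.
Qed.

Lemma measurable_norm_borel :
  measurable_fun setT (fun x : borel TX => `|x : TX|).
Proof. by apply: measurable_continuous_borel; exact: norm_continuous. Qed.

End distances.

Section moments.
Context {R : realType} {TX : completeNormedModType R}.
Context {d : measure_display} {Omega : measurableType d}.
Variables (P : probability Omega R) (sepTX : separable TX).
Implicit Types X Y : {RV P >-> borel TX}.

Let dist X Y (t : Omega) : R := `|(X t : TX) - (Y t : TX)|.

Lemma measurable_dist_RV X Y : measurable_fun setT (dist X Y).
Proof.
apply: (measurableT_comp (measurable_dist sepTX) (g := fun t => (X t, Y t))).
exact: measurable_fun_pair.
Qed.

Lemma moment_ge0 (p : R) (Z : Omega -> TX) : (0 <= moment P p Z)%E.
Proof. by apply: expectation_ge0 => t; exact: powR_ge0. Qed.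

(** The summand 1 covers |x - y| <= 1, where the exponent r cannot be raised to n;
    otherwise |x - y| is at most twice the larger of the two norms. *)
Lemma powR_dist_le (n r : R) (x y : TX) : 0 <= r -> r <= n ->
  `|x - y| `^ r <= 1 + 2 `^ n * (`|x| `^ n + `|y| `^ n).
Proof.
move=> r0 rn; have n0 : 0 <= n by exact: le_trans rn.
have [xy1|xy1] := leP (`|x - y|) 1.
  rewrite (@le_trans _ _ 1)//; last first.
    by rewrite lerDl mulr_ge0// ?addr_ge0// powR_ge0.
  apply: (@le_trans _ _ (1 `^ r)); last by rewrite powR1.
  by rewrite ge0_ler_powR// nnegrE.
apply: (@le_trans _ _ (`|x - y| `^ n)); first by rewrite ler_powR// ltW.
apply: (@le_trans _ _ (2 `^ n * (`|x| `^ n + `|y| `^ n))); last by rewrite lerDr.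
have := ler_normB x y.
wlog xy : x y {xy1} / `|y| <= `|x| => [wlog_xy|].
  have [|/ltW] := leP `|y| `|x|; first exact: wlog_xy.
  by rewrite distrC (addrC `|x|) (addrC (`|x| `^ n)); exact: wlog_xy.
move=> xyD; rewrite (@le_trans _ _ ((2 * `|x|) `^ n))//.
  rewrite ge0_ler_powR ?nnegrE ?mulr_ge0//; move: xyD xy; lra.
by rewrite powRM// ler_wpM2l ?powR_ge0// lerDl powR_ge0.
Qed.

Lemma measurable_powR_norm (p : R) X :
  measurable_fun setT (fun t => `|X t : TX| `^ p).
Proof.
apply: (@measurableT_comp _ _ _ _ _ _ (@powR R ^~ p)) => //.
exact: measurableT_comp measurable_norm_borel _.
Qed.

Lemma measurable_powR_dist (p : R) X Y :
  measurable_fun setT (fun t => dist X Y t `^ p).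
Proof.
apply: (@measurableT_comp _ _ _ _ _ _ (@powR R ^~ p)) => //.
exact: measurable_dist_RV.
Qed.

Lemma finite_moment_dist (n r : R) X Y : 0 <= r -> r <= n ->
  finite_moment n X -> finite_moment n Y ->
  (moment P r (fun t => (X t : TX) - (Y t : TX))%R < +oo)%E.
Proof.
rewrite /finite_moment /moment unlock => r0 rn Xn Yn.
pose normX t : \bar R := (`|X t : TX| `^ n)%R%:E.
pose normY t : \bar R := (`|Y t : TX| `^ n)%R%:E.
have mX : measurable_fun setT normX.
  by apply/measurable_EFinP; exact: measurable_powR_norm.
have mY : measurable_fun setT normY.
  by apply/measurable_EFinP; exact: measurable_powR_norm.
have X0 t : (0 <= normX t)%E by rewrite lee_fin powR_ge0.
have Y0 t : (0 <= normY t)%E by rewrite lee_fin powR_ge0.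
have mXY : measurable_fun setT (fun t => normX t + normY t)%E.
  exact: emeasurable_funD.
have mXY2 : measurable_fun setT (fun t => (2 `^ n)%:E * (normX t + normY t))%E.
  exact: emeasurable_funM.
have XY20 t : (0 <= (2 `^ n)%:E * (normX t + normY t))%E.
  by rewrite mule_ge0 ?adde_ge0// lee_fin powR_ge0.
apply: (@le_lt_trans _ _
    (\int[P]_t (1%:E + (2 `^ n)%:E * (normX t + normY t)))%E).
  apply: ge0_le_integral => //.
  - by apply/measurable_EFinP; exact: measurable_powR_dist.
  - exact: emeasurable_funD.
  - by move=> t _; rewrite /normX /normY -!(EFinD, EFinM) lee_fin powR_dist_le.
rewrite ge0_integralD// ge0_integralZl_EFin ?powR_ge0//; last first.
  by move=> t _; rewrite adde_ge0.
rewrite ge0_integralD// integral_cst// mul1e.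
apply: lte_add_pinfty.
  exact: le_lt_trans (probability_le1 P measurableT) (ltry 1).
by apply: lte_mul_pinfty; rewrite ?lee_fin ?powR_ge0// lte_add_pinfty.
Qed.

End moments.

(** * Bounds on the metrics by moments *)

Section couplings.
Context {R : realType} {TX : completeNormedModType R}.
Implicit Types mu nu : probability (borel TX) R.

Lemma coupling_eq mu mu' nu :
  (forall A, measurable A -> mu A = mu' A) -> coupling mu nu = coupling mu' nu.
Proof.
move=> mumu'; apply/seteqP; split=> gamma [g1 g2]; split=> // A mA.
  by rewrite g1// mumu'.
by rewrite g1// mumu'.
Qed.

Lemma levy_prokhorov_law mu mu' nu : (forall A, measurable A -> mu A = mu' A) ->
  levy_prokhorov mu nu = levy_prokhorov mu' nu.
Proof. by move=> /coupling_eq E; rewrite /levy_prokhorov E. Qed.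

Lemma wasserstein_law s mu mu' nu : (forall A, measurable A -> mu A = mu' A) ->
  wasserstein s mu nu = wasserstein s mu' nu.
Proof. by move=> /coupling_eq E; rewrite /wasserstein E. Qed.

(** This includes the empty set, whose infimum is 0 by convention. *)
Lemma inf_ge0 (S : set R) : (forall x, S x -> 0 <= x) -> 0 <= inf S.
Proof.
move=> S0; have [hS|nhS] := pselect (has_inf S); last by rewrite inf_out.
by apply: lb_le_inf => //; case: hS.
Qed.

Lemma ky_fan_ge0 d (Omega : measurableType d) (P : probability Omega R)
  (X Y : Omega -> TX) : 0 <= ky_fan P X Y.
Proof. by apply: inf_ge0 => e [/ltW]. Qed.

Lemma levy_prokhorov_ge0 mu nu : 0 <= levy_prokhorov mu nu.
Proof. by apply: inf_ge0 => _ [gamma _ <-]; exact: ky_fan_ge0. Qed.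

Lemma wasserstein_ge0 s mu nu : 0 <= wasserstein s mu nu.
Proof.
by apply/fine_ge0/le_ereal_inf_tmp => _ [gamma _ <-]; exact: poweR_ge0.
Qed.

Context {d : measure_display} {Omega : measurableType d}.
Variables (P : probability Omega R) (sepTX : separable TX).
Variables (X Y : {RV P >-> borel TX}) (mu nu : probability (borel TX) R).
Hypotheses (Xmu : has_law P X mu) (Ynu : has_law P Y nu).

Let XY : {RV P >-> (borel TX * borel TX)%type} :=
  rv_of P (measurable_fun_pair (@measurable_funPT _ _ _ _ X)
                               (@measurable_funPT _ _ _ _ Y)).

Let dist (t : Omega) : R := `|(X t : TX) - (Y t : TX)|.

Lemma coupling_joint : coupling mu nu (distribution P XY).
Proof. by split=> A mA; [exact: Xmu|exact: Ynu]. Qed.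

Lemma levy_prokhorov_le_ky_fan :
  levy_prokhorov mu nu <= ky_fan P (X : Omega -> TX) (Y : Omega -> TX).
Proof.
apply: ge_inf; first by exists 0 => _ [gamma _ <-]; exact: ky_fan_ge0.
by exists (distribution P XY); first exact: coupling_joint.
Qed.

Lemma wasserstein_le_moment s a : 0 < s -> 0 <= a ->
  (moment P s (fun t => (X t : TX) - (Y t : TX))%R <= (a `^ s)%:E)%E ->
  wasserstein s mu nu <= a.
Proof.
move=> s0 a0 Ms; rewrite /wasserstein; set S := (S in ereal_inf S).
have S0 : (0 <= ereal_inf S)%E.
  by apply: le_ereal_inf_tmp => _ [gamma _ <-]; exact: poweR_ge0.
suff Sa : (ereal_inf S <= a%:E)%E.
  by rewrite -lee_fin fineK// ge0_fin_numE// (le_lt_trans Sa) ?ltry.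
apply: ge_ereal_inf.
exists (moment P s (fun t => (X t : TX) - (Y t : TX))%R `^ s^-1)%E.
  exists (distribution P XY); first exact: coupling_joint.
  congr (_ `^ _)%E; rewrite /moment unlock ge0_integral_distribution//.
  apply/measurable_EFinP.
  apply: (@measurableT_comp _ _ _ _ _ _ (@powR R ^~ s)) => //.
  exact: measurable_dist.
have -> : a%:E = ((a `^ s)%:E `^ s^-1)%E.
  by rewrite poweR_EFin -powRrM divff ?gt_eqF// powRr1.
rewrite gt0_ler_poweR ?invr_ge0 ?(ltW s0)//.
  by rewrite in_itv/= moment_ge0 leey.
by rewrite in_itv/= lee_fin powR_ge0 leey.
Qed.

(** Markov's inequality: a ^ r P(|X - Y| > a) <= E |X - Y| ^ r <= a ^ r a. *)
Lemma ky_fan_le_moment r a : 0 < r -> 0 < a ->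
  (moment P r (fun t => (X t : TX) - (Y t : TX))%R <= (a `^ (r + 1))%:E)%E ->
  ky_fan P (X : Omega -> TX) (Y : Omega -> TX) <= a.
Proof.
move=> r0 a0 Ma; apply: ge_inf; first by exists 0 => e [/ltW].
split=> //; have mD := measurable_dist_RV sepTX X Y.
have mr : measurable_fun setT (fun x : R => x `^ r) by exact: measurable_powR.
have rinc : {in Num.nneg &, {homo (fun x : R => x `^ r) : x y / x <= y}}.
  by apply: ge0_ler_powR; exact: ltW.
have := @markov _ _ _ P (rv_of P mD) _ a a0 mr (fun x _ => powR_ge0 x r) rinc.
set A := (A in P A) => aA.
have arA : ((a `^ r)%:E * P A <= (a `^ r)%:E * a%:E)%E.
  have -> : ((a `^ r)%:E * a%:E = (a `^ (r + 1))%:E)%E.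
    by rewrite -EFinM powRD ?powRr1 ?(ltW a0)// (gt_eqF a0) implybT.
  apply: le_trans aA (le_trans _ Ma); rewrite le_eqVlt; apply/orP; left; apply/eqP.
  by rewrite /moment; congr expectation; apply/funext => t /=; rewrite normr_id.
have PA : (P A <= a%:E)%E by move: arA; rewrite lee_pmul2l// lte_fin powR_gt0.
apply: le_trans PA; apply: le_measure; rewrite ?inE.
- have -> : [set t | a < `|(X t : TX) - (Y t : TX)|] =
      rv_of P mD @^-1` `]a, +oo[%classic.
    by apply/seteqP; split=> t; rewrite /= in_itv/= andbT.
  exact: measurable_event.
- have -> : A = rv_of P mD @^-1` `[a, +oo[%classic.
    by apply/seteqP; split=> t; rewrite /A /= in_itv/= andbT lee_fin normr_id.
  exact: measurable_event.
- by move=> t /= /ltW; rewrite /A /= lee_fin normr_id.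
Qed.

(** Young's inequality u <= u ^ q / q + (1 - 1 / q) for q = r / s, applied to
    u = (t / a) ^ s. *)
Lemma powR_le_interpolate (s r a t : R) : 0 < s -> s <= r -> 0 < a -> 0 <= t ->
  t `^ s <= a `^ s * (s / r * a `^ (- r)) * t `^ r + a `^ s * (1 - s / r).
Proof.
move=> s0; rewrite le_eqVlt => /predU1P[<-|sr] a0 t0.
  rewrite divff ?gt_eqF// mul1r subrr mulr0 addr0 powRN divff ?mul1r//.
  by rewrite gt_eqF ?powR_gt0.
have r0 : 0 < r by exact: lt_trans sr.
pose u := (t / a) `^ s.
have u0 : 0 <= u by exact: powR_ge0.
have rs0 : 0 < r / s by rewrite divr_gt0.
have q0 : 0 < 1 - s / r by rewrite subr_gt0 ltr_pdivrMr// mul1r.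
have := @conjugate_powR _ u 1 (r / s) (1 - s / r)^-1 u0 ler01 rs0.
rewrite invr_gt0 invf_div invrK => /(_ q0).
rewrite addrC subrK mulr1 powR1 mul1r => /(_ erefl) uE.
have -> : t `^ s = a `^ s * u.
  by rewrite /u -powRM ?(ltW a0)// ?divr_ge0 ?(ltW a0)// mulrC divfK// gt_eqF.
have ur : u `^ (r / s) = a `^ (- r) * t `^ r.
  rewrite /u -powRrM [s * _]mulrC divfK ?gt_eqF// powRM ?invr_ge0 ?(ltW a0)//.
  by rewrite -powR_inv1 ?(ltW a0)// -powRrM mulN1r mulrC.
rewrite -!mulrA -mulrDr ler_wpM2l ?powR_ge0// (le_trans uE)// lerD2r ur.
by rewrite mulrC !mulrA.
Qed.

(** Monotonicity of L^p norms on a probability space, stated through a common bound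
    a: the coefficients of the pointwise bound add up to a ^ s once E |X - Y| ^ r
    is replaced by a ^ r. *)
Lemma moment_interpolate s r a : 0 < s -> s <= r -> 0 < a ->
  (moment P r (fun t => (X t : TX) - (Y t : TX))%R <= (a `^ r)%:E)%E ->
  (moment P s (fun t => (X t : TX) - (Y t : TX))%R <= (a `^ s)%:E)%E.
Proof.
move=> s0 sr a0; rewrite /moment unlock => Ma.
have r0 : 0 < r by exact: lt_le_trans sr.
pose A := a `^ s * (s / r * a `^ (- r)); pose B := a `^ s * (1 - s / r).
have A0 : 0 <= A by rewrite /A !mulr_ge0 ?powR_ge0 ?invr_ge0// ltW.
have B0 : 0 <= B.
  by rewrite /B mulr_ge0 ?powR_ge0// subr_ge0 ler_pdivrMr// mul1r.
pose D t : \bar R := (dist t `^ r)%R%:E.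
have D0 t : (0 <= D t)%E by rewrite lee_fin powR_ge0.
have mD : measurable_fun setT D.
  by apply/measurable_EFinP; exact: measurable_powR_dist.
apply: (@le_trans _ _ (\int[P]_t (A%:E * D t + B%:E))%E).
  apply: ge0_le_integral => //.
  - by apply/measurable_EFinP; exact: measurable_powR_dist.
  - by apply: emeasurable_funD => //; exact: emeasurable_funM.
  - by move=> t _; rewrite /D -EFinM -EFinD lee_fin powR_le_interpolate.
rewrite ge0_integralD//; last 2 first.
- by move=> t _; rewrite mule_ge0.
- exact: emeasurable_funM.
rewrite ge0_integralZl_EFin// integral_cst//.
have -> : (a `^ s)%:E = (A%:E * (a `^ r)%:E + B%:E * 1)%E.
  rewrite mule1 -EFinM -EFinD; congr EFin; rewrite /A /B powRN.
  by rewrite -!mulrA mulVf ?gt_eqF ?powR_gt0// mulr1 -mulrDr subrKC mulr1.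
by apply: leeD; apply: lee_wpmul2l => //; exact: probability_le1.
Qed.

Lemma wasserstein_powR_le s r : 0 < s -> s <= r ->
  (moment P r (fun t => (X t : TX) - (Y t : TX))%R < +oo)%E ->
  wasserstein s mu nu `^ r <=
  fine (moment P r (fun t => (X t : TX) - (Y t : TX))).
Proof.
move=> s0 sr Mfin; have r0 : 0 < r by exact: lt_le_trans sr.
have M0 := @moment_ge0 _ _ _ _ P r (fun t => (X t : TX) - (Y t : TX)).
apply: powR_le_of_dominated => //; first exact: fine_ge0.
  exact: wasserstein_ge0.
move=> a a0 Ma; apply: wasserstein_le_moment => //; first exact: ltW.
apply: moment_interpolate sr a0 _ => //.
by rewrite -lee_fin fineK ?ge0_fin_numE// in Ma.
Qed.

Lemma levy_prokhorov_powR_le r : 0 < r ->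
  (moment P r (fun t => (X t : TX) - (Y t : TX))%R < +oo)%E ->
  levy_prokhorov mu nu `^ (r + 1) <=
  fine (moment P r (fun t => (X t : TX) - (Y t : TX))).
Proof.
move=> r0 Mfin.
have M0 := @moment_ge0 _ _ _ _ P r (fun t => (X t : TX) - (Y t : TX)).
apply: powR_le_of_dominated => //; first by rewrite addr_gt0.
- exact: fine_ge0.
- exact: levy_prokhorov_ge0.
move=> a a0 Ma; apply: le_trans levy_prokhorov_le_ky_fan _.
apply: (ky_fan_le_moment r0 a0).
by rewrite -lee_fin fineK ?ge0_fin_numE// in Ma.
Qed.

End couplings.

(** * The available storage *)

Section storage.
Context {R : realType} {TX TU TW : completeNormedModType R}.
Context {d : measure_display} {Omega : measurableType d}.
Variables (P : probability Omega R) (n l r : R) (f : TX -> TU -> TW -> TX).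
Variables (W : nat -> {RV P >-> borel TW}) (rhoW : probability (borel TW) R).
Variable Y : set ({RV P >-> borel TX} * {RV P >-> borel TU}).
Variable ell : {RV P >-> borel TX} -> {RV P >-> borel TU} -> R.
Variables (Xs : nat -> {RV P >-> borel TX}) (Us : nat -> {RV P >-> borel TU}).
Variables (rhos : probability (borel TX) R).
Variables (pis : {mfun borel TX >-> borel TU}).
Variable dD : probability (borel TX) R -> probability (borel TX) R -> R.
Variables (alpha beta : R -> R).

Local Notation trajectory := (markov_admissible n l f W Y).
Local Notation feasible_state := (state_set Y).

Hypothesis mf : measurable_fun setT
  (fun p : borel TX * borel TU * borel TW => f p.1.1 p.1.2 p.2 : borel TX).
Hypotheses (Wiid : iid P W rhoW) (YL : constraint_in_L n l Y).
Hypothesis Ylaw : constraint_law_invariant Y.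
Hypothesis elllaw : cost_law_invariant Y ell.
Hypothesis Yfeasible : feasible n l f W Y.
Hypothesis copies : noise_independent_copies W Y.
Hypothesis Mfeasible : markov_feasible n l f W Y.
Hypothesis XUs : stationary n l f W Y Xs Us.
Hypothesis rhosE : corresponding Xs Us rhos pis.

Hypothesis dD_law : forall mu mu' : probability (borel TX) R,
  (forall A, measurable A -> mu A = mu' A) -> dD mu rhos = dD mu' rhos.
Hypothesis dD_moment : forall (X : {RV P >-> borel TX}) mu k,
  finite_moment n X -> has_law P X mu ->
  beta (dD mu rhos) <=
  alpha (fine (moment P r (fun t => (X t : TX) - (Xs k t : TX)))).

(** The excess of the stationary cost over the stage cost, increased by the
    dissipation that the storage has to certify. *)
Definition supply (X : {RV P >-> borel TX}) (U : {RV P >-> borel TU}) : R :=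
  ell (Xs 0) (Us 0) - ell X U + beta (dD (distribution P X) rhos).

Definition total_supply (X : nat -> {RV P >-> borel TX})
    (U : nat -> {RV P >-> borel TU}) K : R := \sum_(j < K) supply (X j) (U j).

Definition supplies (mu : probability (borel TX) R) : set R :=
  [set s | exists X U K,
    [/\ trajectory X U, has_law P (X 0) mu & s = total_supply X U K]].

(** Laws from which no trajectory starts, or from which the supplies are unbounded,
    get the value 0 of the supremum convention, so that the storage is bounded
    from below on all probability measures. *)
Definition available_storage mu : R := sup (supplies mu).

Lemma same_law_joint1 (X X' : {RV P >-> borel TX}) (U U' : {RV P >-> borel TU}) :
  same_law P (joint X U) (joint X' U') -> same_law P X X'.
Proof. by move=> XUXU'; exact: (same_law_comp measurable_fst XUXU'). Qed.

Lemma indep_joint1 (X : {RV P >-> borel TX}) (U : {RV P >-> borel TU})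
    (V : {RV P >-> borel TW}) : indep P V (joint X U) -> indep P X V.
Proof.
by move=> /indepC VXU; exact: (indep_comp (X := joint X U) measurable_fst VXU).
Qed.

Lemma dD_same_law (X : {RV P >-> borel TX}) mu :
  has_law P X mu -> dD (distribution P X) rhos = dD mu rhos.
Proof. by move=> Xmu; apply: dD_law => A mA; rewrite -Xmu. Qed.

Lemma supply_same_law (X X' : {RV P >-> borel TX}) (U U' : {RV P >-> borel TU}) :
  Y (X, U) -> Y (X', U') -> same_law P (joint X U) (joint X' U') ->
  supply X U = supply X' U'.
Proof.
move=> YXU YXU' XUXU'; rewrite /supply (elllaw YXU YXU' XUXU').
by rewrite (@dD_same_law _ (distribution P X'))//; exact: same_law_joint1 XUXU'.
Qed.

(** The empty horizon supplies 0. *)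
Lemma available_storage_ge0 mu : 0 <= available_storage mu.
Proof.
have [hs|nhs] := pselect (has_sup (supplies mu)); last first.
  by rewrite /available_storage sup_out.
have [_ [X [U [K [XU X0 _]]]]] := hs.1.
apply: ub_le_sup; first exact: hs.2.
by exists X, U, 0%N; rewrite /total_supply big_ord0.
Qed.

Lemma trajectory_policies X U : trajectory X U ->
  exists2 pi : nat -> {mfun borel TX >-> borel TU},
    (forall k, policy P n l (pi k)) & forall k t, U k t = pi k (X k t).
Proof.
move=> [_ Upi]; exists (fun k => sval (cid2 (Upi k))) => k; first by case: cid2.
by move=> t; case: cid2.
Qed.

Lemma replay_trajectory (X0 : {RV P >-> borel TX}) X U : trajectory X U ->
  indep_process P X0 W -> same_law P X0 (X 0) ->
  exists Z Q, [/\ trajectory Z Q, Z 0 = X0 &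
    forall k, same_law P (joint (Z k) (Q k)) (joint (X k) (U k))].
Proof.
move=> XU X0W X0X; have [pi piP Upi] := trajectory_policies XU.
have [[Xrec XUW _ _ YXU] _] := XU.
apply: (replay mf Wiid YL Ylaw (pi := pi) (V := W)) => //.
- exact: Wiid.2.
- by move=> k; exact: indep_joint1 (XUW k).
- by move=> k A mA; congr (P _); apply/seteqP; split=> t /=; rewrite Xrec.
Qed.

Section bounded.
Variables (lambda : nat -> {RV P >-> borel TX} -> R) (m : R).
Hypothesis lambda_ge : forall k X, finite_moment n X -> m <= lambda k X.
Hypothesis diss : forall X U, trajectory X U -> forall k,
  alpha (fine (moment P r (fun t => (X k t : TX) - (Xs k t : TX)))) <=
  ell (X k) (U k) - ell (Xs 0) (Us 0) + lambda k (X k) - lambda k.+1 (X k.+1).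

(** The supply is at most the decrease of lambda, so the sum telescopes. *)
Lemma total_supply_le X U K : trajectory X U ->
  total_supply X U K <= lambda 0 (X 0) - m.
Proof.
move=> XU; have [[_ _ Xn _ _] _] := XU.
suff le_tele : total_supply X U K <= lambda 0 (X 0) - lambda K (X K).
  by rewrite (le_trans le_tele)// lerD2l lerN2 lambda_ge.
rewrite /total_supply; elim: K => [|K IH]; first by rewrite big_ord0 subrr.
rewrite big_ord_recr/=; have := diss XU K.
have := dD_moment K (Xn K) (fun A _ => erefl (distribution P (X K) A)).
rewrite /supply; move: IH; lra.
Qed.

(** All trajectories with initial law mu are replayed from the same copy X0, so
    lambda(0, X0) - m is a common bound. *)
Lemma has_sup_supplies (X : {RV P >-> borel TX}) mu :
  feasible_state X -> has_law P X mu -> has_sup (supplies mu).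
Proof.
move=> /copies[X0 [YX0 X0X X0W]] Xmu.
have X0mu : has_law P X0 mu := same_law_has X0X Xmu.
split.
  have [X1 [U1 [X10 XU1]]] := Yfeasible YX0 X0W.
  rewrite -X10 in X0W; have [X2 [U2 [X20 XU2]]] := Mfeasible XU1 X0W.
  by exists (total_supply X2 U2 0), X2, U2, 0; split; rewrite // X20 X10.
exists (lambda 0 X0 - m) => _ [X1 [U1 [K [XU1 X1mu ->]]]].
have X01 : same_law P X0 (X1 0) by exact: has_law_same X0mu X1mu.
have [Z [Q [ZQ Z0 ZX]]] := replay_trajectory XU1 X0W X01.
have [[_ _ _ _ YXU] _] := XU1; have [[_ _ _ _ YZQ] _] := ZQ.
rewrite -Z0; apply: le_trans (total_supply_le K ZQ).
rewrite /total_supply le_eqVlt; apply/orP; left; apply/eqP.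
by apply: eq_bigr => j _; apply/esym/supply_same_law.
Qed.

(** From a noise-independent copy of X, apply pi and then the policies of a
    trajectory that starts with the law of Xp. *)
Lemma available_storage_dissipates (pi : {mfun borel TX >-> borel TU})
    (X Xp : {RV P >-> borel TX}) (U : {RV P >-> borel TU})
    (V : {RV P >-> borel TW}) (mu mup : probability (borel TX) R) :
  policy P n l pi -> (forall t, U t = pi (X t)) -> Y (X, U) ->
  has_law P V rhoW -> indep P X V ->
  (forall t, Xp t = f (X t) (U t) (V t)) -> feasible_state Xp ->
  has_law P X mu -> has_law P Xp mup ->
  supply X U + available_storage mup <= available_storage mu.
Proof.
move=> piP Upi YXU Vlaw XV XpE YXp Xmu Xpmup.
have YX : feasible_state X by exists U.
have [mup0 _] := has_sup_supplies YXp Xpmup.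
have [_ mu_ub] := has_sup_supplies YX Xmu.
rewrite -lerBrDl; apply: ge_sup => // _ [X1 [U1 [K [XU1 X1mup ->]]]].
rewrite lerBrDl; apply: ub_le_sup => //.
have [pi1 pi1P U1pi] := trajectory_policies XU1.
have [[X1rec X1W _ _ YXU1] _] := XU1.
have [X0 [YX0 X0X X0W]] := copies YX.
(* The reference sequence: X at time 0, followed by the trajectory X1. *)
pose shift T (x : T) (u : nat -> T) k := if k is k'.+1 then u k' else x.
have [Z [Q [ZQ Z0 ZX]]] : exists Z Q, [/\ trajectory Z Q, Z 0 = X0 &
    forall k, same_law P (joint (Z k) (Q k))
                         (joint (shift _ X X1 k) (shift _ U U1 k))].
  apply: (replay mf Wiid YL Ylaw (pi := shift _ pi pi1)
    (V := shift _ V W)) => //; try by case.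
  - by case=> //= k; exact: Wiid.2.
  - by case=> //= k; exact: indep_joint1 (X1W k).
  - case=> [|k] /=.
      have -> : (fun t => f (X t) (U t) (V t) : borel TX) = Xp.
        by apply/funext.
      exact: has_law_same X1mup Xpmup.
    by move=> A mA; congr (P _); apply/seteqP; split=> t /=; rewrite X1rec.
exists Z, Q, K.+1; split=> //.
  by rewrite Z0; exact: same_law_has X0X Xmu.
have [[_ _ _ _ YZQ] _] := ZQ.
rewrite /total_supply big_ord_recl/=; congr (_ + _).
  by apply/esym/supply_same_law => //; exact: (ZX 0).
by apply: eq_bigr => j _; apply/esym/supply_same_law => //; exact: (ZX j.+1).
Qed.

End bounded.

(** The metric enters through two properties only: its value depends on the laws as
    measures on the Borel sets, and it is dominated by the moment of the
    difference to the stationary process, measured by beta and alpha. *)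
Lemma strict_distributional_dissipative_of_moment :
  class_Kinfty beta ->
  (exists lambda : nat -> {RV P >-> borel TX} -> R,
    (exists m, forall k X, finite_moment n X -> m <= lambda k X) /\
    forall X U, trajectory X U -> forall k,
      alpha (fine (moment P r (fun t => (X k t : TX) - (Xs k t : TX)))) <=
      ell (X k) (U k) - ell (Xs 0) (Us 0) + lambda k (X k) -
      lambda k.+1 (X k.+1)) ->
  strict_distributional_dissipative n l f rhoW Y ell dD rhos pis.
Proof.
move=> Kbeta [lambda [[m lambda_ge] diss]]; exists available_storage, beta.
split=> //; first by exists 0 => mu; exact: available_storage_ge0.
move=> pi X Xp X' U U' V mu mup piP Upi YXU Vlaw XV XpE YXp X'law U'E Xmu Xpmup.
have := available_storage_dissipates lambda_ge diss piP Upi YXU Vlaw XV XpE YXp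
  Xmu Xpmup.
have [[[_ _ _ _ YXUs] _] _ _ _] := XUs.
have X'U' : same_law P (joint X' U') (joint (Xs 0) (Us 0)).
  have -> : joint X' U' = joint X' (pis \o X').
    by apply/funext => t; rewrite /joint U'E.
  exact: rhosE.2.
have YX'U' : Y (X', U') by apply: Ylaw (YXUs 0) _ => A mA; rewrite X'U'.
rewrite /supply (elllaw YX'U' (YXUs 0) X'U') (dD_same_law Xmu); lra.
Qed.

End storage.

(** * Distributional dissipativity *)

Theorem mainTheorem8 (R : realType) (TX TU TW : completeNormedModType R)
    (d : measure_display) (Omega : measurableType d) (P : probability Omega R)
    (n l r : R) (f : TX -> TU -> TW -> TX)
    (W : nat -> {RV P >-> borel TW}) (rhoW : probability (borel TW) R)
    (Y : set ({RV P >-> borel TX} * {RV P >-> borel TU}))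
    (ell : {RV P >-> borel TX} -> {RV P >-> borel TU} -> R)
    (Xs : nat -> {RV P >-> borel TX}) (Us : nat -> {RV P >-> borel TU})
    (rhos : probability (borel TX) R) (pis : {mfun borel TX >-> borel TU}) :
  separable TX -> separable TU -> separable TW ->
  1 <= n -> 1 <= l ->
  caratheodory f rhoW ->
  iid P W rhoW ->
  constraint_in_L n l Y -> constraint_law_invariant Y ->
  cost_law_invariant Y ell ->
  feasible n l f W Y ->
  noise_independent_copies W Y ->
  markov_feasible n l f W Y ->
  1 <= r <= n ->
  stationary n l f W Y Xs Us ->
  stationary_pair P n l f rhoW rhos pis ->
  corresponding Xs Us rhos pis ->
  strict_Lr_dissipative n l f W Y ell r Xs Us ->
  strict_distributional_dissipative n l f rhoW Y ell (@levy_prokhorov R TX)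
    rhos pis /\
  (forall s : R, 1 <= s <= r ->
    strict_distributional_dissipative n l f rhoW Y ell (wasserstein s)
      rhos pis).
Proof.
move=> sepX _ _ _ _ [mf _] Wiid YL Ylaw elllaw Yfeas copies Mfeas /andP[r1 rn].
move=> XUs _ rhosE [lambda [alpha [lambda_ge Kalpha diss]]].
have r0 : 0 < r by exact: lt_le_trans r1.
have [[[_ _ Xsn _ _] _] _ _ _] := XUs.
have moment_fin (X : {RV P >-> borel TX}) k : finite_moment n X ->
    (moment P r (fun t => (X t : TX) - (Xs k t : TX))%R < +oo)%E.
  by move=> Xn; apply: finite_moment_dist (ltW r0) rn Xn (Xsn k).
(* The exponent p is r + 1 for Levy-Prokhorov and r for Wasserstein. *)
suff main dD p : 0 < p ->
    (forall mu mu' : probability (borel TX) R,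
      (forall A, measurable A -> mu A = mu' A) -> dD mu rhos = dD mu' rhos) ->
    (forall (X : {RV P >-> borel TX}) mu k,
      finite_moment n X -> has_law P X mu -> dD mu rhos `^ p <=
      fine (moment P r (fun t => (X t : TX) - (Xs k t : TX)))) ->
    strict_distributional_dissipative n l f rhoW Y ell dD rhos pis.
  split=> [|s /andP[s1 sr]].
    apply: (main _ (r + 1)); first by rewrite addr_gt0.
      by move=> mu mu'; exact: levy_prokhorov_law.
    move=> X mu k Xn Xmu; apply: levy_prokhorov_powR_le => //.
    - exact: rhosE.1.
    - exact: moment_fin.
  apply: (main _ r) => //.
    by move=> mu mu'; exact: wasserstein_law.
  move=> X mu k Xn Xmu; apply: wasserstein_powR_le => //.
  - exact: rhosE.1.
  - exact: lt_le_trans s1.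
  - exact: moment_fin.
move=> p0 dD_law dD_le.
apply: (strict_distributional_dissipative_of_moment (r := r) (alpha := alpha)
  (beta := fun x => alpha (x `^ p)) mf Wiid YL Ylaw elllaw Yfeas copies Mfeas
  XUs rhosE dD_law).
- move=> X mu k Xn Xmu; apply: Kinfty_le => //; first exact: powR_ge0.
  exact: dD_le.
- exact: Kinfty_powR.
- by exists lambda.
Qed.
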